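(* Let $G$ be a finite $P_5$-free graph and let $H$ be a subgraph of $G$ that is $P_3$-connected in $G$. Let $u,v\in V(G)\setminus V(H)$ be such that $uv\in E(G)$, $u$ has no neighbour in $V(H)$, and there is an edge $e\in E(H)$ whose two endpoints are both non-neighbours of $v$. Then $v$ has no neighbour in $V(H)$.
   Context: Graphs are finite and simple; $G$ is $P_5$-free if no induced subgraph is isomorphic to the five-vertex path. A subgraph $H$ of $G$ (not necessarily induced) is $P_3$-connected (in $G$) if $H$ is connected and for every two edges $e,f\in E(H)$ there is a sequence of edges $e=e_0,e_1,\dots,e_k=f$ of $H$ such that for each $0\le i\le k-1$, $e_i$ and $e_{i+1}$ are the two edges of an induced three-vertex path in $G$ (i.e. they share exactly one endpoint and their other endpoints are nonadjacent in $G$). *)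

(* Defs.v *)
From mathcomp Require Import all_boot.

Set Implicit Arguments.
Unset Strict Implicit.
Unset Printing Implicit Defensive.

Record sgraph := SGraph {
  vertex :> finType;
  adj : rel vertex;
  adj_sym : symmetric adj;
  adj_irr : irreflexive adj }.

(* An edge is the two-element set of its endpoints. *)
Definition edges (G : sgraph) : {set {set G}} :=
  [set e | [exists x, exists y, (e == [set x; y]) && adj x y]].

Definition isomorphic (G1 G2 : sgraph) : Prop :=
  exists2 f : G1 -> G2, bijective f & forall x y, adj (f x) (f y) = adj x y.

Section Induced.
Variables (G : sgraph) (A : {set G}).

Definition induced_adj : rel {x : G | x \in A} :=
  fun x y => adj (val x) (val y).

Fact induced_adj_sym : symmetric induced_adj.
Proof. by move=> x y; apply: adj_sym. Qed.

Fact induced_adj_irr : irreflexive induced_adj.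
Proof. by move=> x; apply: adj_irr. Qed.

Definition induced : sgraph := SGraph induced_adj_sym induced_adj_irr.

End Induced.

Section PathGraph.
Variable n : nat.

Definition path_adj : rel 'I_n :=
  fun i j => (i.+1 == j :> nat) || (j.+1 == i :> nat).

Fact path_adj_sym : symmetric path_adj.
Proof. by move=> i j; rewrite /path_adj orbC. Qed.

Fact path_adj_irr : irreflexive path_adj.
Proof. by move=> i; rewrite /path_adj orbb eqn_leq ltnn. Qed.

Definition path_graph : sgraph := SGraph path_adj_sym path_adj_irr.

End PathGraph.

Definition path_free (n : nat) (G : sgraph) : Prop :=
  forall A : {set G}, ~ isomorphic (induced A) (path_graph n).

Record subgraph (G : sgraph) := Subgraph {
  sub_verts : {set G};
  sub_edges : {set {set G}};
  sub_edgesS : sub_edges \subset edges G;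
  sub_edges_verts : forall e, e \in sub_edges -> e \subset sub_verts }.

Definition sub_adj (G : sgraph) (H : subgraph G) : rel G :=
  fun x y => [set x; y] \in sub_edges H.

Definition sub_connected (G : sgraph) (H : subgraph G) : Prop :=
  {in sub_verts H &, forall x y, connect (sub_adj H) x y}.

(* The edges [e] and [f] of [G] are the two edges [xy] and [yz] of an induced
   three-vertex path of [G]; nonadjacency refers to [G], not to a subgraph. *)
Definition P3_linked (G : sgraph) : rel {set G} := fun e f =>
  [exists x, exists y, exists z,
    [&& e == [set x; y], f == [set y; z], adj x y, adj y z,
        x != z & ~~ adj x z]].

Definition P3_connected (G : sgraph) (H : subgraph G) : Prop :=
  sub_connected H /\
  {in sub_edges H &, forall e f : {set G},
    exists s : seq {set G},
      [/\ {subset s <= sub_edges H}, path (@P3_linked G) e s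
        & last e s = f]}.

(* Main.v *)
Require Import Defs.
From mathcomp Require Import all_boot.

(** If an edge [xy] of [H] misses [v] and [xyz] is an induced path with [yz] an
edge of [H], then [v] misses [z] too, since otherwise [u v z y x] would be an
induced five-vertex path.  Hence missing [v] propagates along the sequences of
edges that witness P3-connectedness, and so every edge of [H] misses [v]; by
connectedness these edges cover [H]. *)

(** The image [A] of [p] would induce a path: [p] corestricted to [A] is injective between sets of
    equal size, hence bijective, and its inverse [r] is the forbidden isomorphism. *)
Lemma path_free_no_embedding (n : nat) (G : sgraph) (p : 'I_n -> G) :
  path_free n G -> injective p ->
  ~ (forall i j, adj (p i) (p j) = path_adj i j).
Proof.
move=> Pn_free p_inj p_adj; pose A := [set p i | i in 'I_n].
have pA i : p i \in A by apply: imset_f.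
pose q i : induced A := exist (fun x => x \in A) (p i) (pA i).
have [r qK rK] : bijective q.
  apply: inj_card_bij => [i j [/p_inj] // |].
  by rewrite card_sig -(card_imset 'I_n p_inj); apply: subset_leq_card.
apply: (Pn_free A); exists r; first by exists q.
by move=> a b; rewrite -{2}[a]rK -{2}[b]rK; apply/esym/p_adj.
Qed.

(** All pairs but [c], [e] are prescribed as in the path [a b c d e], so a non-edge there would
    complete an induced path. *)
Lemma P5_free_no_induced_P5 (G : sgraph) (a b c d e : G) :
  path_free 5 G -> uniq [:: a; b; c; d; e] ->
  adj a b -> adj b c -> adj c d -> adj d e ->
  ~~ adj a c -> ~~ adj a d -> ~~ adj a e -> ~~ adj b d -> ~~ adj b e ->
  adj c e.
Proof.
move=> P5_free s_uniq ab bc cd de /negPf ac /negPf ad /negPf ae /negPf bd.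
move=> /negPf be; apply: contraT => /negPf ce.
case: (path_free_no_embedding 5 G (fun i => nth a [:: a; b; c; d; e] i)) => //.
  by move=> i j /eqP; rewrite nth_uniq // => /eqP/val_inj.
move=> [[|[|[|[|[|i]]]]] // Hi] [[|[|[|[|[|j]]]]] // Hj];
  by rewrite /path_adj /= ?adj_irr // adj_sym.
Qed.

(** As [w != y], a walk from [w] to [y] is nonempty, and its first edge contains [w]. *)
Lemma sub_vert_in_edge {G : sgraph} {H : subgraph G} {w y : G} :
  sub_connected H -> w \in sub_verts H -> y \in sub_verts H -> w != y ->
  exists2 e, e \in sub_edges H & w \in e.
Proof.
move=> H_conn wH yH; case/connectP: (H_conn w y wH yH) => [[|z s] /=].
  by move=> _ ->; rewrite eqxx.
by case/andP=> wz _ _ _; exists [set w; z]; last exact: set21.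
Qed.

Lemma P3_linked_misses {G : sgraph} {H : subgraph G} {u v : G} :
  path_free 5 G -> u \notin sub_verts H -> v \notin sub_verts H -> adj u v ->
  {in sub_verts H, forall w, ~~ adj u w} ->
  {in sub_edges H &, forall e f, P3_linked e f ->
    {in e, forall x, ~~ adj v x} -> {in f, forall x, ~~ adj v x}}.
Proof.
move=> P5_free uH vH uv uN e f eH fH.
case/existsP=> x /existsP[y /existsP[z]].
case/and5P=> /eqP def_e /eqP def_f xy yz /andP[xz nxz] vNe.
have [xe ye] : x \in e /\ y \in e by rewrite def_e set21 set22.
have zf : z \in f by rewrite def_f set22.
have [xH yH] : x \in sub_verts H /\ y \in sub_verts H.
  by split; apply: (subsetP (sub_edges_verts eH)).
have zH : z \in sub_verts H by apply: (subsetP (sub_edges_verts fH)).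
(* The shared endpoint [y] lies in [e]; only [z] needs the path argument. *)
move=> w; rewrite def_f => /set2P[->|->]; first exact: vNe.
apply: contraNN nxz => vz; rewrite adj_sym.
have neqH (a b : G) : a \notin sub_verts H -> b \in sub_verts H -> a != b.
  by move=> aH bH; apply: contraNneq aH => ->.
have neq_adj (a b : G) : adj a b -> a != b.
  by move=> ab; apply: contraTneq ab => ->; rewrite adj_irr.
apply: (P5_free_no_induced_P5 G u v z y x) => //; try by [apply: uN | apply: vNe].
(* Distinctness: [u] and [v] are adjacent and lie outside [H], while [x], [y], [z] lie inside. *)
- rewrite /= !inE !negb_or (neq_adj _ _ uv) !(neqH u) // !(neqH v) //=.
  by rewrite [z == y]eq_sym [z == x]eq_sym [y == x]eq_sym xz !neq_adj.
- by rewrite adj_sym.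
- by rewrite adj_sym.
Qed.

Theorem theorem4p1 (G : sgraph) (H : subgraph G) (u v : G)
  (P5_free : path_free 5 G)
  (H_P3_connected : P3_connected H)
  (u_notin_H : u \notin sub_verts H)
  (v_notin_H : v \notin sub_verts H)
  (adj_uv : adj u v)
  (u_anticomplete : forall w, w \in sub_verts H -> ~~ adj u w)
  (v_misses_edge : exists2 e : {set G},
     e \in sub_edges H & forall x, x \in e -> ~~ adj v x) :
  forall w, w \in sub_verts H -> ~~ adj v w.
Proof.
case: H_P3_connected => H_conn H_P3; case: v_misses_edge => e eH vNe.
have vN f : f \in sub_edges H -> {in f, forall x, ~~ adj v x}.
  move=> fH; have [s [sH e_s <-]] := H_P3 e f eH fH.
  (* The starting edge [e] is generalized, so that missing [v] passes to the next edge [g]. *)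
  elim: s e eH vNe sH e_s => //= g s IHs e eH vNe sH /andP[eg g_s].
  have gH : g \in sub_edges H by apply: sH; rewrite mem_head.
  apply: (IHs g) => //; last by move=> h hs; apply: sH; rewrite inE hs orbT.
  exact: (P3_linked_misses P5_free u_notin_H v_notin_H adj_uv) eg vNe.
(* An endpoint of [e] serves as the second vertex that places any other [w] on an edge of [H]. *)
have [y ye] : exists y, y \in e.
  have := subsetP (sub_edgesS H) e eH; rewrite inE.
  by case/existsP=> x /existsP[y /andP[/eqP-> _]]; exists x; apply: set21.
have yH := subsetP (sub_edges_verts eH) y ye.
move=> w wH; have [-> | w_neq_y] := eqVneq w y; first exact: vNe.
by have [f fH wf] := sub_vert_in_edge H_conn wH yH w_neq_y; apply: vN wf.
Qed.
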